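(* Let $\bar\gamma_{\mathrm{E}}>0$, $\mathcal{R}>0$ and $\alpha>0$ be fixed, and let $\bar\gamma_{\mathrm{D}}>0$ with $\bar\gamma_{\mathrm{R}}=\alpha\bar\gamma_{\mathrm{D}}$. Let $h_{\mathrm{S},\mathrm{R}},h_{\mathrm{R},\mathrm{D}},h_{\mathrm{S},\mathrm{E}},h_{\mathrm{R},\mathrm{E}}$ be independent $\mathcal{CN}(0,1)$ random variables, and define $$\mathcal{R}^{3}_{\mathrm{S}\to\mathrm{R}}=\log_2\frac{1+\bar\gamma_{\mathrm{R}}|h_{\mathrm{S},\mathrm{R}}|^2}{1+\bar\gamma_{\mathrm{E}}|h_{\mathrm{S},\mathrm{E}}|^2},\qquad \mathcal{R}^{3}_{\mathrm{R}\to\mathrm{D}}=\log_2\frac{1+\bar\gamma_{\mathrm{D}}|h_{\mathrm{R},\mathrm{D}}|^2}{1+\bar\gamma_{\mathrm{E}}|h_{\mathrm{R},\mathrm{E}}|^2},$$ $\mathcal{R}_3=\max\{\min\{\mathcal{R}^{3}_{\mathrm{S}\to\mathrm{R}},\mathcal{R}^{3}_{\mathrm{R}\to\mathrm{D}}\},0\}$ and $\mathcal{P}_3=\Pr(\mathcal{R}_3<\mathcal{R})$. Then as $\bar\gamma_{\mathrm{D}}\to\infty$, $$\mathcal{P}_3\approx\mathcal{M}_3\bar\gamma_{\mathrm{D}}^{-1},$$ in the sense that $\bar\gamma_{\mathrm{D}}\mathcal{P}_3\to\mathcal{M}_3$, where $\mathcal{M}_3=(2^{\mathcal{R}}-1)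(1+1/\alpha)+2^{\mathcal{R}}\bar\gamma_{\mathrm{E}}(1+1/\alpha)>0$.
   Context: $\mathcal{CN}(0,1)$ denotes a circularly symmetric complex Gaussian random variable with zero mean and unit variance (Rayleigh fading). The quantities model a decode-and-forward relay system where the eavesdropper overhears both source and relay; $\bar\gamma$'s are average SNRs, $\mathcal{R}_3$ the secrecy capacity and $\mathcal{P}_3$ the secrecy outage probability. *)

(* Defs.v *)
From HB Require Import structures.
From mathcomp Require Import all_boot all_order all_algebra.
From mathcomp Require Import all_classical all_reals all_analysis.
Set Implicit Arguments. Unset Strict Implicit. Unset Printing Implicit Defensive.
Import Order.TTheory GRing.Theory Num.Theory.
Import numFieldNormedType.Exports.
Local Open Scope classical_set_scope.
Local Open Scope ring_scope.

(* Mutual independence of a finite family of real random variables: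
   the joint law is the product of the marginals on every family of
   Borel sets (taking B i = setT recovers every subfamily). *)
Definition mutually_independent d (T : measurableType d) (R : realType)
    (P : probability T R) (I : finType) (X : I -> {RV P >-> R}) : Prop :=
  forall B : I -> set R, (forall i, measurable (B i)) ->
    P (\bigcap_(i in [set: I]) (X i @^-1` B i)) =
    (\prod_(i : I) P (X i @^-1` B i))%E.

(* X has the normal law N(m, s^2) (s = standard deviation). *)
Definition has_normal_law d (T : measurableType d) (R : realType)
    (P : probability T R) (X : {RV P >-> R}) (m s : R) : Prop :=
  forall A : set R, measurable A -> distribution P X A = normal_prob m s A.

(* Four complex channel coefficients h_k = X (k,false) + i X (k,true),
   k : 'I_4 with 0 = (S,R), 1 = (R,D), 2 = (S,E), 3 = (R,E).
   They are independent CN(0,1) iff the eight real components are mutually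
   independent, each with law N(0, 1/2). *)
Definition iid_CN01 d (T : measurableType d) (R : realType)
    (P : probability T R) (X : 'I_4 * bool -> {RV P >-> R}) : Prop :=
  mutually_independent X /\
  forall k, has_normal_law (X k) 0 (Num.sqrt (2^-1)).

Definition abs2h d (T : measurableType d) (R : realType)
    (P : probability T R) (X : 'I_4 * bool -> {RV P >-> R}) (k : 'I_4) (t : T) : R :=
  X (k, false) t ^+ 2 + X (k, true) t ^+ 2.

Definition log2 (R : realType) (x : R) : R := ln x / ln 2.

Definition rate3 d (T : measurableType d) (R : realType)
    (P : probability T R) (X : 'I_4 * bool -> {RV P >-> R})
    (gE alpha gD : R) (t : T) : R :=
  let gR := alpha * gD in
  let RSR := log2 ((1 + gR * abs2h X 0 t) / (1 + gE * abs2h X 2 t)) in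
  let RRD := log2 ((1 + gD * abs2h X 1 t) / (1 + gE * abs2h X 3 t)) in
  Num.max (Num.min RSR RRD) 0.

Definition outage3 d (T : measurableType d) (R : realType)
    (P : probability T R) (X : 'I_4 * bool -> {RV P >-> R})
    (gE alpha Rt gD : R) : R :=
  fine (P [set t | rate3 X gE alpha gD t < Rt]).

Definition M3 (R : realType) (gE alpha Rt : R) : R :=
  (2 `^ Rt - 1) * (1 + alpha^-1) + 2 `^ Rt * gE * (1 + alpha^-1).

(* Main.v *)
Require Import Defs.
From HB Require Import structures.
From mathcomp Require Import all_boot all_order all_algebra.
From mathcomp Require Import all_classical all_reals all_analysis.
From mathcomp Require Import measurable_realfun ring.
Import Order.TTheory GRing.Theory Num.Theory.
Import numFieldNormedType.Exports.
Local Open Scope classical_set_scope.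
Local Open Scope ring_scope.

(* Each squared modulus |h|^2 is exponentially distributed.  Substituting y = x t
   in the plane Gaussian integral decouples the radius from the slope t and gives
   E[1_(|h|^2 >= u) exp(- b |h|^2)] = exp(- (1 + b) u) / (1 + b), with the factor
   pi coming from the integral of 1 / (1 + t^2).  Hence a single hop meets the
   target rate, an event of the form |h|^2 >= a + b |h'|^2, with probability
   exp(- a) / (1 + b).  The two hops depend on disjoint blocks of the independent
   components, so the outage probability has the closed form
     1 - exp(- a / g) / ((1 + b1 / g) (1 + b2 / g)),    g = gD,
   and g times it tends to a + b1 + b2 = M3. *)

(** * Integration against normal laws and on the real line *)

(** The Radon-Nikodym derivative of the normal law and [normal_pdf] have the same integral over
    every measurable set, hence agree almost everywhere. *)
Lemma ge0_integral_normal_prob (R : realType) (m s : R) (f : R -> \bar R) :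
    measurable_fun [set: R] f -> (forall x, 0 <= f x)%E ->
  (\int[normal_prob m s]_x f x =
   \int[lebesgue_measure]_x (f x * (normal_pdf m s x)%:E))%E.
Proof.
move=> mf f0; have dom := normal_prob_dominates m s.
rewrite -(Radon_Nikodym_SigmaFinite.change_of_variables dom f0)//.
have idens := Radon_Nikodym_SigmaFinite.f_integrable dom.
have mpdf : measurable_fun setT (EFin \o normal_pdf m s).
  by apply/measurable_EFinP; exact: measurable_normal_pdf.
apply: ae_eq_integral => //.
- by apply: emeasurable_funM => //; exact: measurable_int idens.
- exact: emeasurable_funM.
apply: ae_eqe_mul2l; apply: integral_ae_eq => // E _ mE.
by rewrite -Radon_Nikodym_SigmaFinite.f_integral.
Qed.

(** Multiplication by [c] pulls []a, b]] back to an interval of length [(b - a) / c], so [c] times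
    the pushforward of Lebesgue measure agrees with Lebesgue measure on half-open intervals, hence
    everywhere. *)
Lemma ge0_integral_scale (R : realType) (c : R) (f : R -> \bar R) : 0 < c ->
    measurable_fun [set: R] f -> (forall x, 0 <= f x)%E ->
  (\int[lebesgue_measure]_x f x = c%:E * \int[lebesgue_measure]_x f (c * x)%R)%E.
Proof.
move=> c0 mf f0.
have mc : measurable_fun [set: measurableTypeR R]
    ( *%R c : measurableTypeR R -> measurableTypeR R).
  exact: measurable_funM.
have mfc : measurable_fun [set: R] (fun x => f (c * x)) by exact: measurableT_comp.
pose k : {nonneg R} := NngNum (ltW c0).
rewrite -[c]/(k%:num) -ge0_integral_mscale//=.
rewrite -[in RHS](preimage_setT ( *%R c : measurableTypeR R -> measurableTypeR R)).
rewrite -(ge0_integral_pushforward mc (mscale k (@lebesgue_measure R)))//.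
apply: eq_measure_integral => //= A mA _; apply: lebesgue_measure_unique => //.
move=> _ [[a b]] _ <-.
transitivity (c%:E * lebesgue_measure `](a / c)%R, (b / c)%R])%E; last first.
  rewrite /= /pushforward /mscale/=; congr (_ * lebesgue_measure _)%E.
  apply/seteqP; split => x /=; rewrite !in_itv/= ltr_pdivrMr// ler_pdivlMr//;
    by rewrite [x * c]mulrC.
rewrite !lebesgue_measure_itv/= !lte_fin ltr_pM2r ?invr_gt0//.
case: ifP => _; last by rewrite mule0.
by rewrite -!EFinB -EFinM -mulrBl mulrC divfK ?gt_eqF.
Qed.

Lemma ge0_integral_even (R : realType) (f : R -> \bar R) :
    measurable_fun [set: R] f -> (forall x, 0 <= f x)%E ->
    (forall x, f (- x)%R = f x) ->
  (\int[lebesgue_measure]_x f x =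
   2%:E * \int[lebesgue_measure]_(x in `[0%R, +oo[) f x)%E.
Proof.
move=> mf f0 ev.
rewrite -[X in (\int[_]_(_ in X) _ = _)%E](setUv `[0%R, +oo[) ge0_integral_setU//=;
  last 3 first.
- exact: measurableC.
- by rewrite setUv.
- exact/disj_setPCl.
rewrite mule_natl mule2n; congr +%E.
rewrite setCitvr integral_itv_bndo_bndc; last exact: measurable_funTS.
rewrite ge0_integration_by_substitution0//.
by apply: eq_integral => x _; rewrite ev.
Qed.

(** A constant multiple of a rescaled [gauss_fun] is a primitive of the integrand and vanishes at
    infinity. *)
Lemma integral_idM_gauss_tail (R : realType) (c r : R) : 0 < c -> 0 <= r ->
  (\int[lebesgue_measure]_(x in `[r, +oo[) (x * expR (- (c * x ^+ 2)))%:E =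
   (expR (- (c * r ^+ 2)) / (2 * c))%:E)%E.
Proof.
move=> c0 r0.
pose F (x : R) := - (2 * c)^-1 * expR (- (c * x ^+ 2)).
have dF (x : R) : is_derive x (1 : R) F (x * expR (- (c * x ^+ 2))).
  apply: is_derive_eq; rewrite /GRing.scale/=.
  by field; rewrite gt_eqF.
have cf : continuous (fun x : R => x * expR (- (c * x ^+ 2))).
  move=> x; apply: differentiable_continuous; apply/derivable1_diffP.
  exact: ex_derive.
have cF : continuous F.
  by move=> x; apply: differentiable_continuous; apply/derivable1_diffP.
rewrite (@ge0_continuous_FTC2y _ _ F r 0).
- by rewrite /F sub0e -EFinN mulNr opprK mulrC.
- by move=> x rx; rewrite mulr_ge0 ?expR_ge0// (le_trans r0).
- exact: continuous_subspaceT.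
- rewrite -(mulr0 (- (2 * c)^-1)); apply: cvgM; first exact: cvg_cst.
  rewrite (_ : (fun _ => _) = gauss_fun \o (fun x => x * Num.sqrt c)); last first.
    by apply/funext => x; rewrite /gauss_fun /= exprMn sqr_sqrtr ?ltW// mulrC.
  apply: cvg_comp (@cvg_gauss_fun R).
  by apply: gt0_cvgMly; [rewrite sqrtr_gt0|exact: cvg_id].
- by move=> x _; exact: ex_derive.
- by apply: cvg_at_right_filter; exact: cF.
- by move=> x _; rewrite derive1E derive_val.
Qed.

Lemma integralT_oneDsqrV (R : realType) :
  (\int[lebesgue_measure]_x ((1 + x ^+ 2 : R)^-1)%:E = pi%:E)%E.
Proof.
rewrite ge0_integral_even.
- by rewrite integral0y_oneDsqr -EFinM mulrC divfK.
- apply/measurable_EFinP; apply: continuous_measurable_fun.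
  exact: continuous_oneDsqrV.
- by move=> x; rewrite lee_fin invr_ge0 addr_ge0 ?sqr_ge0.
- by move=> x; rewrite sqrrN.
Qed.

(** * The plane Gaussian integral outside a disc *)

Lemma measurable_exp_tail (R : realType) (k u : R) :
  measurable_fun [set: R] (fun r => \1_`[u, +oo[ r * expR (- (k * r))).
Proof.
apply: measurable_funM; first exact: measurable_indic.
by apply: measurableT_comp => //; apply: measurableT_comp.
Qed.

Lemma double_integral_exp_tail (R : realType) (k u : R) : 0 < k -> 0 <= u ->
  (\int[lebesgue_measure]_x \int[lebesgue_measure]_y
     (\1_`[u, +oo[ (x ^+ 2 + y ^+ 2) * expR (- (k * (x ^+ 2 + y ^+ 2))))%:E =
   (pi * expR (- (k * u)) / k)%:E)%E.
Proof.
move=> k0 u0; pose psi (r : R) := \1_`[u, +oo[ r * expR (- (k * r)).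
have psi0 r : 0 <= psi r by rewrite mulr_ge0// expR_ge0.
have mpsi : measurable_fun [set: R] psi := measurable_exp_tail R k u.
pose f (z : R * R) : \bar R := (psi (z.1 ^+ 2 + z.2 ^+ 2))%:E.
have mf : measurable_fun [set: R * R] f.
  apply/measurable_EFinP; apply: measurableT_comp => //.
  by apply: measurable_funD; apply: measurable_funX.
have mF : measurable_fun [set: R]
    (fun x : R => \int[lebesgue_measure]_y f (x, y))%E.
  have f0 z : (0 <= f z)%E by rewrite lee_fin psi0.
  exact: (@measurable_fun_fubini_tonelli_F _ _ _ _ R lebesgue_measure f mf f0).
rewrite ge0_integral_even; last 3 first.
- exact: mF.
- by move=> x; apply: integral_ge0 => y _; rewrite lee_fin psi0.
- by move=> x; rewrite sqrrN.
(* The factor [z.1] is the Jacobian of [y = x t]. The indicator of [x > 0] keeps [g] nonnegative on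
   the whole plane, so that Tonelli applies to it. *)
pose g (z : R * R) : \bar R :=
  (\1_`]0, +oo[ z.1 * (z.1 * psi (z.1 ^+ 2 * (1 + z.2 ^+ 2))))%:E.
have mg : measurable_fun [set: R * R] g.
  apply/measurable_EFinP; apply: measurable_funM.
    by apply: measurableT_comp => //; exact: measurable_indic.
  apply: measurable_funM => //; apply: measurableT_comp => //.
  apply: measurable_funM; first exact: measurable_funX.
  by apply: measurable_funD => //; exact: measurable_funX.
have g0 z : (0 <= g z)%E.
  rewrite lee_fin; have [z0|z0] := ltP 0 z.1.
    by rewrite !mulr_ge0// ltW.
  by rewrite indicE memNset ?mul0r//= in_itv/= andbT ltNge z0.
(* the substitution y = x t *)
transitivity (2%:E * \int[lebesgue_measure]_x \int[lebesgue_measure]_t g (x, t))%E.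
  (* The endpoint 0 is dropped because the substitution needs [x > 0]. *)
  congr (_ * _)%E; rewrite -integral_itv_obnd_cbnd; last first.
    apply: measurable_funTS.
    exact: mF.
  rewrite integral_mkcond; apply: eq_integral => x _; rewrite patchE.
  case: ifPn; rewrite ?notin_setE ?inE /= in_itv/= andbT => x0; last first.
    rewrite integral0_eq// => y _.
    by rewrite /g /= indicE memNset ?mul0r//= in_itv/= andbT.
  have mfx : measurable_fun [set: R] (fun y : R => f (x, y)).
    exact: measurableT_comp.
  rewrite (@ge0_integral_scale _ x (fun y => f (x, y)) x0 mfx)//; last first.
    by move=> y; rewrite lee_fin psi0.
  rewrite -ge0_integralZl//; last 3 first.
  - by apply: (measurableT_comp mfx); exact: measurable_funM.
  - by move=> y _; rewrite lee_fin psi0.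
  - by rewrite lee_fin ltW.
  apply: eq_integral => t _; rewrite /g/= indicE mem_set/= ?in_itv/= ?x0//.
  rewrite mul1r /f/= -EFinM; congr (_ * psi _)%:E; ring.
have -> : (\int[lebesgue_measure]_x \int[lebesgue_measure]_t g (x, t) =
    \int[lebesgue_measure]_t \int[lebesgue_measure]_x g (x, t))%E.
  exact: (@fubini_tonelli _ _ _ _ R lebesgue_measure lebesgue_measure g mg g0).
transitivity (2%:E * \int[lebesgue_measure]_t
    ((expR (- (k * u)) / (2 * k))%:E * ((1 + t ^+ 2)^-1)%:E))%E; last first.
  rewrite ge0_integralZl//; last 3 first.
  - apply/measurable_EFinP; apply: continuous_measurable_fun.
    exact: continuous_oneDsqrV.
  - by move=> x _; rewrite lee_fin invr_ge0 addr_ge0 ?sqr_ge0.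
  - by rewrite lee_fin divr_ge0 ?expR_ge0 ?mulr_ge0 ?ltW.
  rewrite integralT_oneDsqrV -!EFinM; congr EFin.
  by field; rewrite gt_eqF.
congr (_ * _)%E; apply: eq_integral => t _; rewrite /g/=.
have s0 : 0 < 1 + t ^+ 2 by rewrite ltr_pwDl ?sqr_ge0.
set s := 1 + t ^+ 2 in s0 *.
(* For [x > 0], [x ^+ 2 * s >= u] means [x >= Num.sqrt (u / s)]. At this threshold the exponent is
   [k * u] for every slope [t], so only the factor [1 / s] depends on [t]. *)
transitivity (\int[lebesgue_measure]_(x in `[Num.sqrt (u / s), +oo[)
   (x * expR (- ((k * s) * x ^+ 2)))%:E)%E; last first.
  rewrite integral_idM_gauss_tail ?mulr_gt0// ?sqrtr_ge0//.
  rewrite sqr_sqrtr ?divr_ge0 ?(ltW s0)// -EFinM; congr EFin.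
  rewrite (_ : k * s * (u / s) = k * u); last by field; rewrite gt_eqF.
  by rewrite invfM invfM -!mulrA; congr (_ * _); field; rewrite !gt_eqF.
rewrite [RHS]integral_mkcond; apply: eq_integral => x _; rewrite patchE.
have [x0|x0] := leP x 0.
  rewrite indicE memNset /= ?in_itv/= ?andbT ?ltNge ?x0// mul0r.
  case: ifPn => //; rewrite inE /= in_itv/= andbT => sx.
  (* Here [x <= 0] lies above a square root, so it is 0 and the factor [x] of the integrand
     vanishes. *)
  have -> : x = 0.
    by apply/eqP; rewrite eq_le x0 (le_trans _ sx)// sqrtr_ge0.
  by rewrite mul0r.
rewrite indicE mem_set/= ?in_itv/= ?x0// mul1r /psi indicE.
have -> : (x \in `[Num.sqrt (u / s), +oo[%classic) = (x ^+ 2 * s \in `[u, +oo[%classic).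
  apply/idP/idP; rewrite !inE/= !in_itv/= !andbT -ler_pdivrMr//.
    by move=> h; rewrite -[leLHS]sqr_sqrtr ?divr_ge0 ?(ltW s0)// ler_sqr ?nnegrE ?sqrtr_ge0// ltW.
  by move=> h; rewrite -[leRHS]ger0_norm ?(ltW x0)// -sqrtr_sqr ler_wsqrtr.
case: ifPn => _; last by rewrite mul0r mulr0.
by rewrite mul1r; do 4 f_equal; ring.
Qed.

(** * Independence of disjoint blocks of variables *)

Section block_independence.
Context {d} {T : measurableType d} {R : realType} {P : probability T R}.
Context {I : finType} (X : I -> {RV P >-> R}).

(* A pi-system generating the sigma-algebra of the [X j], [j \in J]. *)
Definition block_cylinders (J : {set I}) : set (set T) :=
  [set E | exists B : I -> set R, [/\ forall i, measurable (B i),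
    forall i, i \notin J -> B i = setT &
    E = \bigcap_(i in [set: I]) (X i @^-1` B i)]].

Lemma block_cylinders_setI (J : {set I}) : setI_closed (block_cylinders J).
Proof.
move=> _ _ [B [mB BT ->]] [C [mC CT ->]].
exists (fun i => B i `&` C i); split.
- by move=> i; exact: measurableI.
- by move=> i iJ; rewrite BT// CT// setTI.
- by rewrite -bigcapI; apply: eq_bigcapr => i _; rewrite preimage_setI.
Qed.

Lemma measurable_cylinder (B : I -> set R) : (forall i, measurable (B i)) ->
  measurable (\bigcap_(i in [set: I]) (X i @^-1` B i)).
Proof.
move=> mB; apply: fin_bigcap_measurable => [|i _]; first exact: finite_finset.
by rewrite -[X in measurable X]setTI; exact: measurable_funP.
Qed.

Lemma g_block_measurable (J : {set I}) :
  <<s block_cylinders J >> `<=` (measurable : set (set T)).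
Proof.
apply: smallest_sub; first exact: sigma_algebra_measurable.
by move=> _ [B [mB _ ->]]; exact: measurable_cylinder.
Qed.

Lemma measurable_fun_block (J : {set I}) (j : I) : j \in J ->
  measurable_fun [set: g_sigma_algebraType (block_cylinders J)]
    (X j : g_sigma_algebraType (block_cylinders J) -> R).
Proof.
move=> jJ _ B mB; rewrite setTI; apply: sub_sigma_algebra.
exists (fun i => if i == j then B else setT); split.
- by move=> i; case: ifP.
- by move=> i iJ; case: eqP iJ => // ->; rewrite jJ.
- apply/seteqP; split => [t Bt i _ /=|t /(_ j Logic.I)/=]; last by rewrite eqxx.
  by case: eqP => // ->.
Qed.

Lemma g_block_preimage (J : {set I}) (f : T -> R) (A : set R) :
    measurable_fun [set: g_sigma_algebraType (block_cylinders J)]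
      (f : g_sigma_algebraType (block_cylinders J) -> R) ->
  measurable A -> <<s block_cylinders J >> (f @^-1` A).
Proof. by move=> mf mA; have := mf measurableT A mA; rewrite setTI. Qed.

(** The Dynkin class of events independent of [F]: finiteness of [P] handles proper differences,
    continuity from below handles increasing unions. *)
Lemma indep_lambda_system (F : set T) : measurable F ->
  lambda_system setT
    [set E | measurable E /\ P (E `&` F) = (P E * P F)%E].
Proof.
move=> mF; split => //=.
- by split => //; rewrite setTI probability_setT mul1e.
- move=> A B BA [mA PA] [mB PB]; split; first exact: measurableD.
  have fin (Z : set T) : measurable Z -> P Z \is a fin_num by move=> ?; exact: fin_num_measure.
  have -> : (A `\` B) `&` F = (A `&` F) `\` (B `&` F).
    rewrite setIDAC; apply/seteqP; split => t /=; tauto.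
  rewrite !measureD//; last 4 first.
  - by rewrite ltey_eq fin.
  - exact: measurableI.
  - exact: measurableI.
  - by rewrite ltey_eq fin//; exact: measurableI.
  rewrite (setIidr BA) (setIidr (@setSI _ F _ _ BA)).
  by rewrite muleBl ?fin ?fin_num_adde_defr ?fin//; congr (_ - _)%E.
- move=> G ndG mG; have mG1 i : measurable (G i) by case: (mG i).
  have mUG : measurable (\bigcup_i G i) by exact: bigcupT_measurable.
  split => //.
  have c1 : P (G i `&` F) @[i --> \oo] --> P (\bigcup_i G i `&` F).
    rewrite setI_bigcupl; apply: nondecreasing_cvg_mu.
    + by move=> i; exact: measurableI.
    + by apply: bigcupT_measurable => i; exact: measurableI.
    + by move=> m n mn; apply/subsetPset; apply: setSI; apply/subsetPset/ndG.
  have c2 : P (G i `&` F) @[i --> \oo] --> (P (\bigcup_i G i) * P F)%E.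
    under eq_fun do rewrite (mG _).2.
    apply: cvgeZr; first exact: fin_num_measure.
    exact: nondecreasing_cvg_mu.
  exact: cvg_unique c1 c2.
Qed.

Hypothesis indepX : mutually_independent X.

(** The pi-lambda theorem is applied twice, starting from cylinders and replacing one block at a
    time by its sigma-algebra. *)
Lemma indep_blocks (J K : {set I}) (E F : set T) : {in J, forall i, i \notin K} ->
  <<s block_cylinders J >> E -> <<s block_cylinders K >> F ->
  P (E `&` F) = (P E * P F)%E.
Proof.
move=> JK.
(* Every index lies outside [J] or outside [K], so one of its two constraints is [setT], of
   probability 1, and the product over all indices splits factor by factor. *)
have base A B : block_cylinders J A -> block_cylinders K B ->
    P (A `&` B) = (P A * P B)%E.
  move=> [C [mC CT ->]] [D [mD DT ->]].
  rewrite -bigcapI; under eq_bigcapr do rewrite -preimage_setI.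
  rewrite !indepX//; last by move=> i; exact: measurableI.
  rewrite -big_split/=; apply: eq_bigr => i _.
  have [iJ|iJ] := boolP (i \in J).
    by rewrite DT ?(JK _ iJ)// setIT preimage_setT probability_setT mule1.
  by rewrite CT// setTI preimage_setT probability_setT mul1e.
have extend (L : {set I}) (G : set T) : measurable G ->
    (forall A, block_cylinders L A -> P (A `&` G) = (P A * P G)%E) ->
    forall A, <<s block_cylinders L >> A -> P (A `&` G) = (P A * P G)%E.
  move=> mG LG A LA.
  suff : [set E | measurable E /\ P (E `&` G) = (P E * P G)%E] A by case.
  have := @lambda_system_subset T (block_cylinders L) (block_cylinders_setI L) setT _
    (indep_lambda_system _ mG).
  apply => //.
  move=> B LB; split; last exact: LG.
  by apply: (g_block_measurable L); exact: sub_sigma_algebra.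
(* [E] is first reduced to a cylinder [A] with [F] fixed, then [F] to a cylinder [B] with [A]
   fixed. *)
move=> JE KF; apply: (extend J) JE => [|A JA].
  exact: (g_block_measurable K).
rewrite setIC muleC; apply: (extend K) KF => [|B KB].
  by apply: (g_block_measurable J); exact: sub_sigma_algebra.
by rewrite setIC muleC; exact: base.
Qed.

End block_independence.

(** * Expectations of functions of independent variables *)

(** Product values on rectangles determine the joint law of [(U, V)] as the product measure; Tonelli
    then gives the iterated integral, which is carried back to [T]. *)
Lemma ge0_integral_indep_pair (d : measure_display) (T : measurableType d)
    (R : realType) (P : probability T R) (U V : {RV P >-> R})
    (f : R * R -> \bar R) :
    (forall A B, measurable A -> measurable B ->
      P (U @^-1` A `&` V @^-1` B) = (P (U @^-1` A) * P (V @^-1` B))%E) ->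
    measurable_fun [set: R * R] f -> (forall z, 0 <= f z)%E ->
  (\int[P]_t f (U t, V t) = \int[P]_s \int[P]_t f (U s, V t))%E.
Proof.
move=> UV mf f0.
have mUV : measurable_fun [set: T] (fun t => (U t, V t)).
  exact: measurable_fun_pair.
transitivity (\int[pushforward P (fun t => (U t, V t))]_z f z)%E.
  by rewrite (ge0_integral_pushforward mUV).
transitivity (\int[distribution P U \x distribution P V]_z f z)%E.
  apply: eq_measure_integral => //= A mA _; apply/esym.
  exact: product_measure_unique.
pose F x := (\int[distribution P V]_y f (x, y))%E.
have mF : measurable_fun [set: R] F.
  exact: (@measurable_fun_fubini_tonelli_F _ _ _ _ R (distribution P V) f mf f0).
transitivity (\int[distribution P U]_x F x)%E.
  exact: (@fubini_tonelli1 _ _ _ _ R (distribution P U) (distribution P V) f mf f0).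
rewrite ge0_integral_distribution//; last first.
  by move=> x; apply: integral_ge0 => y _; exact: f0.
apply: eq_integral => s _; rewrite /= /F ge0_integral_distribution//.
exact: measurableT_comp.
Qed.

(** At variance 1/2 the product of the densities of the two components of a channel is
    [exp(-(x^2 + y^2)) / pi], a function of the squared modulus. *)
Lemma normal_pdf_halfE (R : realType) (x : R) :
  normal_pdf 0 (Num.sqrt 2^-1) x = (Num.sqrt pi)^-1 * expR (- x ^+ 2).
Proof.
have s2 : Num.sqrt (2^-1 : R) ^+ 2 = 2^-1 by rewrite sqr_sqrtr.
(* [normal_pdf] has a separate branch for a zero standard deviation. *)
rewrite /normal_pdf ifF; last by rewrite sqrtr_eq0 leNgt invr_gt0 ltr0n.
rewrite /normal_peak /normal_fun s2 subr0; congr ((Num.sqrt _)^-1 * expR _).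
  by rewrite -mulr_natr; field.
by rewrite -mulr_natr; field.
Qed.

(** * The limit of the closed form *)

(** With [e] the exponential and [D] the denominator, [1 - e / D = (1 - e) + e * (D - 1) / D], and
    [g * (D - 1) = b1 + b2 + b1 * b2 / g]. The two summands times [g] tend to [a] and [b1 + b2]. *)
Lemma cvg_mul_onem_exp_div (R : realType) (a b1 b2 : R) :
    0 <= a -> 0 <= b1 -> 0 <= b2 ->
  g * (1 - expR (- (a / g)) / ((1 + b1 / g) * (1 + b2 / g)))
    @[g --> +oo] --> a + b1 + b2.
Proof.
move=> a0 b10 b20.
have Vg : (g^-1 : R) @[g --> +oo] --> (0 : R).
  by apply/gtr0_cvgV0; [exact: nbhs_pinfty_gt|exact: cvg_id].
have zg c : (c / g : R) @[g --> +oo] --> (0 : R).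
  by rewrite -(mulr0 c); apply: cvgM => //; exact: cvg_cst.
have cg c : (1 + c / g : R) @[g --> +oo] --> (1 : R).
  rewrite -[X in _ --> X]addr0; apply: cvgD => //; exact: cvg_cst.
have e1 : (expR (- (a / g)) : R) @[g --> +oo] --> (1 : R).
  rewrite -(@expR0 R) -oppr0.
  apply: continuous_cvg; first exact: continuous_expR.
  exact: cvgN.
have e2 : g * (1 - expR (- (a / g))) @[g --> +oo] --> a.
  (* Both bounds come from [1 + x <= expR x]: at [x = - (a / g)] for the upper one, at [x = a / g],
     after inversion, for the lower one. *)
  apply: (@squeeze_cvgr _ _ _ _ (fun g => a / (1 + a / g)) (fun=> a)).
  - near=> g; have g0 : 0 < g by [].
    have ag : 0 <= a / g by rewrite divr_ge0// ltW.
    have ag1 : 0 < 1 + a / g by rewrite ltr_pwDl.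
    apply/andP; split; last first.
      rewrite mulrC -ler_pdivlMr// lerBlDl -lerBlDr; exact: expR_ge1Dx.
    rewrite (_ : a / _ = g * (1 - (1 + a / g)^-1)); last first.
      by field; rewrite !gt_eqF// ltr_wpDr.
    rewrite ler_pM2l// lerB// expRN lef_pV2 ?posrE ?expR_gt0//.
    exact: expR_ge1Dx.
  - rewrite -[X in _ --> X]divr1; apply: cvgM; first exact: cvg_cst.
    by apply: cvgV.
  - exact: cvg_cst.
have q : (b1 + b2 + b1 * (b2 / g)) / ((1 + b1 / g) * (1 + b2 / g)) @[g --> +oo] --> b1 + b2.
  rewrite -[X in _ --> X]divr1; apply: cvgM.
    rewrite -[X in _ --> X]addr0; apply: cvgD; first exact: cvg_cst.
    by rewrite -(mulr0 b1); apply: cvgM => //; exact: cvg_cst.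
  apply: cvgV => //; rewrite -[X in _ --> X]mulr1; exact: cvgM.
have : g * (1 - expR (- (a / g))) + expR (- (a / g)) *
    ((b1 + b2 + b1 * (b2 / g)) / ((1 + b1 / g) * (1 + b2 / g))) @[g --> +oo] --> a + 1 * (b1 + b2).
  by apply: cvgD => //; exact: cvgM.
rewrite mul1r addrA; apply: cvg_trans; apply: near_eq_cvg.
near=> g; have g0 : 0 < g by [].
have h1 : 1 + b1 / g != 0 by rewrite gt_eqF// ltr_pwDl// divr_ge0// ltW.
have h2 : 1 + b2 / g != 0 by rewrite gt_eqF// ltr_pwDl// divr_ge0// ltW.
by field; rewrite !gt_eqF// ltr_wpDr.
Unshelve. all: by end_near. Qed.

(** * The law of a squared channel modulus *)

Lemma ge0_integral_normal_law (d : measure_display) (T : measurableType d)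
    (R : realType) (P : probability T R) (X : {RV P >-> R}) (m s : R)
    (f : R -> \bar R) : has_normal_law X m s ->
    measurable_fun [set: R] f -> (forall x, 0 <= f x)%E ->
  (\int[P]_t f (X t) =
   \int[lebesgue_measure]_x (f x * (normal_pdf m s x)%:E))%E.
Proof.
move=> lawX mf f0.
(* [R] and [measurableTypeR R] have the same measurable sets but different displays. *)
pose Y : T -> measurableTypeR R := X.
have mY : measurable_fun [set: T] Y.
  by move=> mT A mA; have := @measurable_funP _ _ _ _ setT X mT A mA.
rewrite -(ge0_integral_normal_prob _ _ _ _ mf f0).
transitivity (\int[pushforward P Y]_x f x)%E.
  by rewrite (ge0_integral_pushforward mY).
by apply: eq_measure_integral => //= A mA _; rewrite -lawX.
Qed.

Section rayleigh.
Context {d} {T : measurableType d} {R : realType} {P : probability T R}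
  (X : 'I_4 * bool -> {RV P >-> R}).

Lemma measurable_abs2h_block (J : {set 'I_4 * bool}) (k : 'I_4) :
    (k, false) \in J -> (k, true) \in J ->
  measurable_fun [set: g_sigma_algebraType (block_cylinders X J)]
    (abs2h X k : g_sigma_algebraType (block_cylinders X J) -> R).
Proof.
move=> kf kt; apply: measurable_funD; apply: measurable_funX;
  exact: measurable_fun_block.
Qed.

Lemma measurable_abs2h (k : 'I_4) : measurable_fun [set: T] (abs2h X k).
Proof. by apply: measurable_funD; apply: measurable_funX. Qed.

(** Makes [abs2h X k] a random variable, the form in which [ge0_integral_indep_pair] takes its
    arguments. *)
HB.instance Definition _ (k : 'I_4) :=
  isMeasurableFun.Build _ _ _ _ (abs2h X k) (measurable_abs2h k).

Lemma abs2h_ge0 (k : 'I_4) (t : T) : 0 <= abs2h X k t.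
Proof. by rewrite addr_ge0 ?sqr_ge0. Qed.

Hypothesis iidX : iid_CN01 X.

(** One formula for two uses: [b = 0] gives the tail probability of the exponential law, [u = 0] its
    Laplace transform. *)
Lemma integral_exp_tail_abs2h (k : 'I_4) (b u : R) : 0 <= b -> 0 <= u ->
  (\int[P]_t (\1_`[u, +oo[ (abs2h X k t) * expR (- (b * abs2h X k t)))%:E =
   (expR (- ((1 + b) * u)) / (1 + b))%:E)%E.
Proof.
move=> b0 u0; have [indepX lawX] := iidX.
have b1 : 0 < 1 + b by rewrite ltr_pwDl.
pose psi (r : R) := \1_`[u, +oo[ r * expR (- (b * r)).
have psi0 r : 0 <= psi r by rewrite mulr_ge0// expR_ge0.
have mpsi : measurable_fun [set: R] psi := measurable_exp_tail R b u.
pose f (z : R * R) : \bar R := (psi (z.1 ^+ 2 + z.2 ^+ 2))%:E.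
have f0 z : (0 <= f z)%E by rewrite lee_fin psi0.
have mf : measurable_fun [set: R * R] f.
  apply/measurable_EFinP; apply: measurableT_comp => //.
  by apply: measurable_funD; apply: measurable_funX.
have mfx x : measurable_fun [set: R] (fun y => f (x, y)) by exact: measurableT_comp.
transitivity (\int[P]_s \int[P]_t f (X (k, false) s, X (k, true) t))%E.
  rewrite -ge0_integral_indep_pair// => A B mA mB.
  apply: (indep_blocks X indepX [set (k, false)]%SET [set (k, true)]%SET).
  - by move=> i; rewrite !inE => /eqP ->; rewrite xpair_eqE andbF.
  - by apply: g_block_preimage => //; apply: measurable_fun_block; rewrite inE.
  - by apply: g_block_preimage => //; apply: measurable_fun_block; rewrite inE.
transitivity (\int[lebesgue_measure]_x ((\int[lebesgue_measure]_y
    (f (x, y) * (normal_pdf 0 (Num.sqrt 2^-1) y)%:E)) *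
    (normal_pdf 0 (Num.sqrt 2^-1) x)%:E))%E.
  pose F x := (\int[P]_t f (x, X (k, true) t))%E.
  have FE x : F x = (\int[lebesgue_measure]_y
      (f (x, y) * (normal_pdf 0 (Num.sqrt 2^-1) y)%:E))%E.
    exact: (ge0_integral_normal_law _ _ _ _ _ _ _ (fun y => f (x, y)) (lawX (k, true))).
  (* [F] is a partial integral over [R * T], so Tonelli provides its measurability. *)
  have mF : measurable_fun [set: R] F.
    apply: (@measurable_fun_fubini_tonelli_F _ _ _ _ R P
      (fun z : R * T => f (z.1, X (k, true) z.2))) => //.
    apply: measurableT_comp => //; apply: measurable_fun_pair => //=.
    exact: measurableT_comp.
  rewrite (ge0_integral_normal_law _ _ _ _ _ _ _ F (lawX (k, false)))//.
    by apply: eq_integral => x _; rewrite FE.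
  by move=> x; apply: integral_ge0.
(* The weight [exp(-(x^2 + y^2))] of the two densities is absorbed into the exponential, raising the
   rate from [b] to [1 + b] and leaving the constant [1 / pi]. *)
pose phi (r : R) := \1_`[u, +oo[ r * expR (- ((1 + b) * r)).
have phi0 r : 0 <= phi r by rewrite mulr_ge0// expR_ge0.
have mphi : measurable_fun [set: R] phi := measurable_exp_tail R (1 + b) u.
pose g (z : R * R) : \bar R := (phi (z.1 ^+ 2 + z.2 ^+ 2))%:E.
have g0 z : (0 <= g z)%E by rewrite lee_fin phi0.
have mg : measurable_fun [set: R * R] g.
  apply/measurable_EFinP; apply: measurableT_comp => //.
  by apply: measurable_funD; apply: measurable_funX.
have mpdf : measurable_fun [set: R] (EFin \o normal_pdf 0 (Num.sqrt (2^-1 : R))).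
  by apply/measurable_EFinP; exact: measurable_normal_pdf.
have pi0 : (0 <= pi^-1%:E :> \bar R)%E by rewrite lee_fin invr_ge0 pi_ge0.
transitivity (\int[lebesgue_measure]_x (pi^-1%:E *
    (\int[lebesgue_measure]_y g (x, y))))%E.
  apply: eq_integral => x _.
  rewrite -ge0_integralZl//; last exact: measurableT_comp.
  rewrite -ge0_integralZr//; last 3 first.
  - exact: (emeasurable_funM (mfx x) mpdf).
  - by move=> y _; rewrite mule_ge0// lee_fin normal_pdf_ge0.
  - by rewrite lee_fin normal_pdf_ge0.
  apply: eq_integral => y _; rewrite /f /g /psi /phi/= !normal_pdf_halfE -!EFinM.
  congr EFin; rewrite (_ : (1 + b) * _ = b * (x ^+ 2 + y ^+ 2) + y ^+ 2 + x ^+ 2).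
    rewrite !opprD !expRD -{3}(@sqr_sqrtr _ (pi : R)) ?pi_ge0//.
    by field; rewrite gt_eqF// sqrtr_gt0 pi_gt0.
  ring.
rewrite ge0_integralZl//.
- rewrite double_integral_exp_tail// -EFinM; congr EFin.
  by rewrite -!mulrA mulKf// gt_eqF// pi_gt0.
- exact: (@measurable_fun_fubini_tonelli_F _ _ _ _ R lebesgue_measure g mg g0).
- by move=> x _; apply: integral_ge0.
Qed.

End rayleigh.

(** * The outage probability in closed form *)

Section secrecy_outage.
Context {d} {T : measurableType d} {R : realType} {P : probability T R}
  (X : 'I_4 * bool -> {RV P >-> R}).
Hypothesis iidX : iid_CN01 X.

(** Given [abs2h X j = y], the exponential tail is [exp(-(a + b y))]; averaging over [y] is a
    Laplace transform at [b]. *)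
Lemma prob_abs2h_ge_affine (i j : 'I_4) (a b : R) : i != j -> 0 <= a -> 0 <= b ->
  P [set t | a + b * abs2h X j t <= abs2h X i t] = (expR (- a) / (1 + b))%:E.
Proof.
move=> ij a0 b0; have [indepX _] := iidX.
have b1 : 0 < 1 + b by rewrite ltr_pwDl.
set E := [set t | _].
pose f (z : R * R) : \bar R := (\1_`[0, +oo[ (z.2 - (a + b * z.1)))%:E.
have f0 z : (0 <= f z)%E by rewrite lee_fin.
have mf : measurable_fun [set: R * R] f.
  apply/measurable_EFinP; apply: measurableT_comp; first exact: measurable_indic.
  by apply: measurable_funB => //; apply: measurable_funD => //;
     exact: measurable_funM.
have mE : measurable E.
  have -> : E = (fun t => abs2h X i t - (a + b * abs2h X j t)) @^-1` `[0, +oo[.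
    by apply/seteqP; split => t; rewrite /E /= in_itv/= andbT subr_ge0.
  rewrite -[X in measurable X]setTI.
  apply: measurable_funB => //; apply: measurable_funD => //.
  exact: measurable_funM.
transitivity (\int[P]_t f (abs2h X j t, abs2h X i t))%E.
  rewrite -[E]setIT -integral_indic//; apply: eq_integral => t _.
  rewrite /f/= !indicE; congr (_%:R)%:E; congr nat_of_bool.
  by apply/idP/idP; rewrite !inE /E/= in_itv/= andbT subr_ge0.
rewrite (ge0_integral_indep_pair _ _ _ P
  (abs2h X j : {RV P >-> R}) (abs2h X i : {RV P >-> R}))//; last first.
  move=> A B mA mB.
  apply: (indep_blocks X indepX [set (j, false); (j, true)]%SET
    [set (i, false); (i, true)]%SET).
  - by move=> [k []]; rewrite !inE !xpair_eqE ?andbF ?andbT ?orbF/= => /eqP ->;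
      rewrite eq_sym.
  - by apply: g_block_preimage => //; apply: measurable_abs2h_block;
      rewrite !inE eqxx ?orbT.
  - by apply: g_block_preimage => //; apply: measurable_abs2h_block;
      rewrite !inE eqxx ?orbT.
(* The indicator of [[0, +oo[] equals 1 on squared moduli; it puts the integrand in the shape of
   [integral_exp_tail_abs2h] with [u = 0]. *)
transitivity (\int[P]_s ((expR (- a))%:E *
    (\1_`[0, +oo[ (abs2h X j s) * expR (- (b * abs2h X j s)))%:E))%E.
  apply: eq_integral => s _.
  have u0 : 0 <= a + b * abs2h X j s by rewrite addr_ge0// mulr_ge0// abs2h_ge0.
  (* The factor [expR (- (0 * _))] is 1, which gives the case [b = 0] of the same formula. *)
  transitivity (\int[P]_t (\1_`[a + b * abs2h X j s, +oo[ (abs2h X i t) *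
     expR (- (0 * abs2h X i t)))%:E)%E.
    apply: eq_integral => t _; rewrite mul0r oppr0 expR0 mulr1 /f/= !indicE.
    congr (_%:R)%:E; congr nat_of_bool.
    by apply/idP/idP; rewrite !inE/= !in_itv/= !andbT subr_ge0.
  rewrite integral_exp_tail_abs2h// addr0 mul1r divr1 -EFinM.
  rewrite indicE mem_set/= ?in_itv/= ?abs2h_ge0// mul1r.
  by rewrite opprD expRD.
rewrite ge0_integralZl//.
  by rewrite integral_exp_tail_abs2h// mulr0 oppr0 expR0 mul1r -EFinM.
apply/measurable_EFinP.
exact: (measurableT_comp (measurable_exp_tail R b 0) (measurable_abs2h X j)).
Qed.

(** As [Rt > 0], the maximum with 0 is below [Rt] exactly when the minimum is. The negated
    conjunction presents outage as the complement of two hop events to which independence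
    applies. *)
Lemma rate3_ltE (gE alpha Rt gD : R) (t : T) :
    0 < gE -> 0 < Rt -> 0 < alpha -> 0 < gD ->
  (rate3 X gE alpha gD t < Rt) =
  ~~ (((2 `^ Rt - 1) / (alpha * gD) + 2 `^ Rt * gE / (alpha * gD) * abs2h X 2 t
         <= abs2h X 0 t) &&
      ((2 `^ Rt - 1) / gD + 2 `^ Rt * gE / gD * abs2h X 3 t <= abs2h X 1 t)).
Proof.
move=> gE0 Rt0 al0 gD0.
have ln20 : 0 < ln (2 : R) by rewrite ln_gt0// ltr1n.
have link (g x y : R) : 0 < g -> 0 <= x -> 0 <= y ->
    (log2 ((1 + g * x) / (1 + gE * y)) < Rt) =
    ~~ ((2 `^ Rt - 1) / g + 2 `^ Rt * gE / g * y <= x).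
  move=> g0 x0 y0.
  have x1 : 0 < 1 + g * x by rewrite ltr_pwDl// mulr_ge0// ltW.
  have y1 : 0 < 1 + gE * y by rewrite ltr_pwDl// mulr_ge0// ltW.
  rewrite -ltNge /log2 ltr_pdivrMr// -ln_powR ltr_ln ?posrE ?divr_gt0 ?powR_gt0//.
  rewrite ltr_pdivrMr// -[in RHS](ltr_pM2l g0).
  rewrite [X in _ = (_ < X)](_ : _ = 2 `^ Rt * (1 + gE * y) - 1); last first.
    by field; rewrite gt_eqF.
  by rewrite ltrBrDl.
rewrite /rate3 /Order.max/=.
rewrite gt_max Rt0 andbT gt_min !link ?abs2h_ge0 ?mulr_gt0//.
by rewrite negb_and.
Qed.

(** The success probabilities of the hops multiply, so their exponents, of orders [1 / (alpha * gD)]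
    and [1 / gD], add up to the factor [1 + alpha^-1]. *)
Lemma outage3E (gE alpha Rt gD : R) :
    0 < gE -> 0 < Rt -> 0 < alpha -> 0 < gD ->
  outage3 X gE alpha Rt gD =
  1 - expR (- ((2 `^ Rt - 1) * (1 + alpha^-1) / gD)) /
    ((1 + 2 `^ Rt * gE / alpha / gD) * (1 + 2 `^ Rt * gE / gD)).
Proof.
move=> gE0 Rt0 al0 gD0; have [indepX _] := iidX.
have c1 : 1 <= 2 `^ Rt by rewrite -[leLHS](powRr0 2) ler_powR// ?ler1n// ltW.
have c0 : 0 < 2 `^ Rt := lt_le_trans ltr01 c1.
have ag0 : 0 < alpha * gD by rewrite mulr_gt0.
pose S (g : R) (i j : 'I_4) :=
  [set t | (2 `^ Rt - 1) / g + 2 `^ Rt * gE / g * abs2h X j t <= abs2h X i t].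
have PS g i j : 0 < g -> i != j ->
    P (S g i j) = (expR (- ((2 `^ Rt - 1) / g)) / (1 + 2 `^ Rt * gE / g))%:E.
  move=> g0 ij; apply: prob_abs2h_ge_affine => //.
    by rewrite divr_ge0 ?subr_ge0// ltW.
  by rewrite divr_ge0 ?mulr_ge0// ltW.
have blockS g i j (J : {set 'I_4 * bool}) :
    (forall b, (i, b) \in J) -> (forall b, (j, b) \in J) ->
    <<s block_cylinders X J >> (S g i j).
  move=> iJ jJ.
  have -> : S g i j = (fun t => abs2h X i t - ((2 `^ Rt - 1) / g +
      2 `^ Rt * gE / g * abs2h X j t)) @^-1` `[0, +oo[.
    by apply/seteqP; split => t; rewrite /S /= in_itv/= andbT subr_ge0.
  apply: g_block_preimage => //; apply: measurable_funB => //.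
    exact: measurable_abs2h_block.
  apply: measurable_funD => //; apply: measurable_funM => //.
  exact: measurable_abs2h_block.
(* The first hop involves channels 0 and 2, the second 1 and 3, so [J 0 2] and [J 1 3] are
   disjoint. *)
pose J k l : {set 'I_4 * bool} := [set p | (p.1 == k) || (p.1 == l)]%SET.
have JS g i j : <<s block_cylinders X (J i j) >> (S g i j).
  by apply: blockS => b; rewrite inE/= eqxx ?orbT.
have mS g i j : measurable (S g i j) by apply: g_block_measurable (JS g i j).
rewrite /outage3.
have -> : [set t | rate3 X gE alpha gD t < Rt] =
    ~` (S (alpha * gD) 0 2 `&` S gD 1 3).
  apply/seteqP; split => t /=; rewrite rate3_ltE//.
    by move=> /negP h [h1 h2]; apply: h; rewrite h1 h2.
  by move=> h; apply/negP => /andP[h1 h2]; apply: h.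
rewrite probability_setC; last exact: measurableI.
have -> : P (S (alpha * gD) 0 2 `&` S gD 1 3) =
    (P (S (alpha * gD) 0 2)%R * P (S gD 1 3)%R)%E.
  apply: (indep_blocks X indepX (J 0 2) (J 1 3)) => //.
  by move=> [k b]; rewrite !inE/= => /orP[] /eqP ->.
rewrite !PS// -EFinM -EFinB/=; congr (1 - _).
rewrite mulf_div -expRD -opprD; congr (expR (- _) / (_ * _)).
  by field; rewrite !gt_eqF.
by congr (_ + _); field; rewrite !gt_eqF.
Qed.

End secrecy_outage.

Theorem theorem8 (d : measure_display) (T : measurableType d) (R : realType)
    (P : probability T R) (X : 'I_4 * bool -> {RV P >-> R})
    (gE Rt alpha : R) :
  0 < gE -> 0 < Rt -> 0 < alpha ->
  iid_CN01 X ->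
  0 < M3 gE alpha Rt /\
  (gD * outage3 X gE alpha Rt gD) @[gD --> +oo] --> M3 gE alpha Rt.
Proof.
move=> gE0 Rt0 al0 iidX.
have c1 : 1 <= 2 `^ Rt by rewrite -[leLHS](powRr0 2) ler_powR// ?ler1n// ltW.
have c0 : 0 < 2 `^ Rt := lt_le_trans ltr01 c1.
have V0 : 0 < 1 + alpha^-1 by rewrite addr_gt0// invr_gt0.
split.
  by rewrite /M3 ltr_wpDl// ?mulr_gt0// mulr_ge0 ?subr_ge0// ltW.
(* Regrouped as [a + b1 + b2], with [b1] from the source-relay hop and [b2] from the
   relay-destination hop. *)
have -> : M3 gE alpha Rt =
    (2 `^ Rt - 1) * (1 + alpha^-1) + 2 `^ Rt * gE / alpha + 2 `^ Rt * gE.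
  by rewrite /M3; ring.
apply: cvg_trans (@cvg_mul_onem_exp_div R _ _ _ _ _ _).
(* The closed form requires [0 < g], which holds near [+oo]. *)
- apply: near_eq_cvg; near=> g.
  by rewrite outage3E.
- by rewrite mulr_ge0 ?subr_ge0// ltW.
- by rewrite divr_ge0 ?mulr_ge0// ltW.
- by rewrite mulr_ge0// ltW.
Unshelve. all: by end_near. Qed.
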